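(* The grey wolf optimizer holds order-1 stability under the stagnation assumption: for every search agent $i$ and coordinate $j$, if $x_{ij}^{(T)}(t)$, $1\le t\le T$, denotes the $j$th coordinate of the position of agent $i$ at iteration $t$ of the grey wolf optimizer with $T$ iterations in total, then the limit of the expectation at the final iteration, $\lim_{T\to\infty}\mathbb{E}\,x_{ij}^{(T)}(T)$, exists.
   Context: Setting: the GWO process for agent $i$ and coordinate $j$ under the stagnation assumption, i.e. the coordinates $p_{1j},p_{2j},p_{3j}\in\mathbb{R}$ of the three best search agents are constants (independent of $t$ and $T$). For each $T\ge1$, the initial value $x_{ij}^{(T)}(1)$ is uniformly distributed on the feasible interval $[l_j,r_j]$, $l_j<r_j$ (the same for all $T$), and for $1\le t<T$ $$x_{ij}^{(T)}(t+1)=\tfrac13\sum_{k=1}^3p_{kj}+\tfrac13\sum_{k=1}^3A_{kj}(t)\,|C_{kj}(t)p_{kj}-x_{ij}^{(T)}(t)|,$$ where $A_{kj}(t)\sim U[-a(t),a(t)]$, $C_{kj}(t)\sim U[0,2]$, $a(t)=2(1-t/T)$, and all variables $A_{kj}(t),C_{kj}(t)$ (over all $k,t$) are independent of each other and of the initial value. $U[p,q]$ is the uniform distribution on $[p,q]$. Order-1 stability of a meta-heuristic algorithm means that for any search agent $i$ the limit of $\mathbb{E}x_{ij}(t)$ as $t\to\infty$ exists; since the GWO runs for exactly $T$ iterations, the limit is taken at the final iteration $t=T$ as $T\to\infty$. *)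

(* Defs.v *)
From HB Require Import structures.
From mathcomp Require Import all_boot all_order all_algebra.
From mathcomp Require Import all_classical all_reals all_analysis.

Set Implicit Arguments.
Unset Strict Implicit.
Unset Printing Implicit Defensive.

Import Order.TTheory GRing.Theory Num.Theory.
Import numFieldNormedType.Exports.

Local Open Scope classical_set_scope.
Local Open Scope ring_scope.

(* The endpoints must satisfy [a < b]: [uniform_prob] takes the proof. *)
Definition uniformly_distributed d (Omega : measurableType d) (R : realType)
    (P : probability Omega R) (X : {RV P >-> R}) (a b : R) : Prop :=
  exists ab : a < b, forall B : set R, measurable B ->
    distribution P X B = uniform_prob ab B.

(* Mutual independence of the subfamily of [X] indexed by [D]; finite subsets
   of [D] are given by duplicate-free sequences. *)
Definition mutually_independent d (Omega : measurableType d) (R : realType)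
    (P : probability Omega R) (I : choiceType) (D : pred I)
    (X : I -> {RV P >-> R}) : Prop :=
  forall (J : seq I) (B : I -> set R),
    uniq J -> {subset J <= D} -> (forall s, measurable (B s)) ->
    P [set w | forall s, s \in J -> B s (X s w)] =
    (\prod_(s <- J) P (X s @^-1` B s))%E.

(* Index of the sources of randomness of one coordinate of one agent:
   [None] is the initial position, [Some (inl (k, t))] is A_k(t) and
   [Some (inr (k, t))] is C_k(t). *)
Definition gwo_index : choiceType := option ('I_3 * nat + 'I_3 * nat)%type.

(* Only the iterations 1 <= t < T draw random coefficients. *)
Definition gwo_index_dom (T : nat) : pred gwo_index := fun s =>
  match s with
  | None => true
  | Some (inl (_, t)) | Some (inr (_, t)) => (1 <= t < T)%N
  end.

Definition gwo_source d (Omega : measurableType d) (R : realType)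
    (P : probability Omega R) (x1 : {RV P >-> R})
    (A C : 'I_3 -> nat -> {RV P >-> R}) (s : gwo_index) : {RV P >-> R} :=
  match s with
  | None => x1
  | Some (inl (k, t)) => A k t
  | Some (inr (k, t)) => C k t
  end.

Definition gwo_a (R : realType) (T t : nat) : R := 2 * (1 - t%:R / T%:R).

(* The run of length [T] of one coordinate of one agent, on the feasible
   interval [l, r]; [p k] is the coordinate of the k-th best agent, a constant
   by stagnation. The values of [x] outside 1 .. T and of [A], [C] outside
   1 .. T - 1 are irrelevant. *)
Record gwo_process d (Omega : measurableType d) (R : realType)
    (P : probability Omega R) (T : nat) (l r : R) (p : 'I_3 -> R)
    (A C : 'I_3 -> nat -> {RV P >-> R}) (x : nat -> {RV P >-> R}) : Prop := {
  gwo_init : uniformly_distributed (x 1%N) l r;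
  gwo_uniformA : forall k t, (1 <= t < T)%N ->
    uniformly_distributed (A k t) (- gwo_a R T t) (gwo_a R T t);
  gwo_uniformC : forall k t, (1 <= t < T)%N ->
    uniformly_distributed (C k t) 0 2;
  gwo_independent :
    mutually_independent (gwo_index_dom T) (gwo_source (x 1%N) A C);
  gwo_step : forall t, (1 <= t < T)%N -> forall w,
    x t.+1 w = 3^-1 * (\sum_(k < 3) p k)
             + 3^-1 * (\sum_(k < 3) A k t w * `|C k t w * p k - x t w|)
}.

(* [x T i j t] is coordinate [j] of agent [i] at iteration [t] of the run with
   [T] iterations in total. *)
Definition order1_stable (R : realType) (d : nat -> measure_display)
    (Omega : forall T, measurableType (d T))
    (P : forall T, probability (Omega T) R) (m n : nat)
    (x : forall T, 'I_m -> 'I_n -> nat -> {RV (P T) >-> R}) : Prop :=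
  forall (i : 'I_m) (j : 'I_n), exists L : R,
    ('E_(P T)[x T i j T])%E @[T --> \oo] --> (L%:E)%E.

(* Main.v *)
Require Import Defs.
From HB Require Import structures.
From mathcomp Require Import all_boot all_order all_algebra.
From mathcomp Require Import all_classical all_reals all_analysis.
From mathcomp Require Import measurable_realfun.

Set Implicit Arguments.
Unset Strict Implicit.
Unset Printing Implicit Defensive.

Import Order.TTheory GRing.Theory Num.Theory.
Import numFieldNormedType.Exports.

Local Open Scope classical_set_scope.
Local Open Scope ring_scope.

(** From the second iteration on the mean of the position does not depend on
    [T] at all: it equals the average of the three leaders.

    In the update giving [x (t + 1)] the coefficient [A k t] is multiplied by
    [`|C k t * p k - x t|]. Unfolding the recursion, that factor is a
    measurable function of the initial position and of coefficients other
    than [A k t], so it is independent of [A k t]. Since [A k t] is uniform on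
    an interval symmetric around [0], it is centered: the expectation of each
    product is [0 * E `|C k t * p k - x t| = 0], and only the constant average
    of the [p k] survives. For [2 <= T] the final iteration [T] is such an
    update, so the sequence of expectations is eventually constant.

    Two facts carry this argument. Mutual independence is given as a product
    rule on finite families of events [X s \in B s]; these events form a
    pi-system, so uniqueness of measures extends the rule to the sigma-algebra
    they generate, that is, to every measurable function of the other sources
    ([mutually_independent_rv]). And the expectation of a product of two
    independent integrable variables factorizes because their joint law is the
    product of their laws, to which Fubini's theorem applies
    ([integrable_independentM], [integral_independentM]). The first of these
    two lemmas also carries the induction showing that every position is
    integrable, without any bound on the trajectories. *)

(** * Products of independent variables *)

Section independence.
Context d (Omega : measurableType d) (R : realType) (P : probability Omega R).

Definition independent_rv (X Y : {RV P >-> R}) : Prop :=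
  forall A B : set R, measurable A -> measurable B ->
    P (X @^-1` A `&` Y @^-1` B) = (P (X @^-1` A) * P (Y @^-1` B))%E.

Section product.
Variables X Y : {RV P >-> R}.

Let XY (w : Omega) : R * R := (X w, Y w).

Let measurable_XY : measurable_fun setT XY.
Proof. by apply: measurable_fun_pair. Qed.

HB.instance Definition _ := isMeasurableFun.Build _ _ _ _ XY measurable_XY.

Hypothesis XYindep : independent_rv X Y.

(** A finite measure on a product is determined by its values on rectangles,
    and on these the equality is independence itself. *)
Lemma independent_joint_law (E : set (R * R)) : measurable E ->
  (distribution P X \x distribution P Y)%E E = distribution P XY E.
Proof.
by move=> mE; exact: product_measure_unique.
Qed.

Hypothesis intX : P.-integrable setT (EFin \o X).
Hypothesis intY : P.-integrable setT (EFin \o Y).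

Let mul (z : R * R) : \bar R := (z.1 * z.2)%:E.

Let measurable_mul : measurable_fun setT mul.
Proof. by apply/measurable_EFinP; apply: measurable_funM. Qed.

(** By Tonelli's theorem the integral of [`|x * y|] against the product of the
    laws is the product of the two first absolute moments. *)
Let integrable_mul :
  (distribution P X \x distribution P Y)%E.-integrable [set: R * R] mul.
Proof.
have [_ fX] := integrableP _ _ _ intX; have [_ fY] := integrableP _ _ _ intY.
have absE (Z : {RV P >-> R}) : (\int[distribution P Z]_z `|z|%:E =
    \int[P]_w `|(EFin \o Z) w|)%E.
  by rewrite ge0_integral_distribution//; exact: measurableT_comp.
apply/integrable12ltyP => //.
under eq_integral do under eq_integral do rewrite /mul/= normrM EFinM.
have mabs : measurable_fun setT (fun y : R => `|y|%:E).
  by apply/measurable_EFinP.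
under eq_integral do rewrite ge0_integralZl// ?lee_fin// absE.
rewrite ge0_integralZr//; last by apply: integral_ge0.
rewrite absE.
by rewrite lte_mul_pinfty// ?ge0_fin_numE// integral_ge0.
Qed.

Lemma integrable_independentM : P.-integrable setT (fun w => (X w * Y w)%:E).
Proof.
have [_ fXY] := integrableP _ _ _ integrable_mul.
apply/integrableP; split; first by apply/measurable_EFinP; exact: measurable_funM.
have mabs : measurable_fun setT (abse \o mul) by exact: measurableT_comp.
rewrite -(@ge0_integral_distribution _ _ _ _ _ P XY _ mabs)//; last first.
  by move=> y /=.
rewrite (eq_measure_integral (distribution P X \x distribution P Y)%E)//.
by move=> A mA _; exact/esym/independent_joint_law.
Qed.

(** Read on the product of the two laws, the integral of [x * y] splits by
    Fubini's theorem. *)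
Lemma integral_independentM :
  (\int[P]_w (X w * Y w)%:E = (\int[P]_w (X w)%:E) * \int[P]_w (Y w)%:E)%E.
Proof.
rewrite -(@integral_distribution _ _ _ _ _ P XY mul)//; last first.
  exact: integrable_independentM.
rewrite (eq_measure_integral (distribution P X \x distribution P Y)%E)//; last first.
  by move=> A mA _; exact/esym/independent_joint_law.
rewrite -integral12_prod_meas1//.
have iY : (distribution P Y).-integrable setT EFin.
  by apply: integrable_pushforward.
have EY x : (\int[distribution P Y]_y mul (x, y) =
    x%:E * \int[P]_w (EFin \o Y) w)%E.
  under eq_integral do rewrite /mul/= EFinM.
  by rewrite integralZl// (@integral_distribution _ _ _ _ _ P Y EFin).
rewrite (eq_integral (fun x : R => x%:E * \int[P]_w (EFin \o Y) w)%E); last first.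
  by move=> x _; exact: EY.
have fY : (\int[P]_w (EFin \o Y) w)%E \is a fin_num by exact: integrable_fin_num.
rewrite -(fineK fY) integralZr//; last by apply: integrable_pushforward.
by rewrite (@integral_distribution _ _ _ _ _ P X EFin).
Qed.

End product.

(** * From mutual independence to generated sigma-algebras *)

(** Sequences of indices are duplicate-free so that the product rule of
    [mutually_independent] applies to cylinders as they are. *)
Definition cylinder (I : choiceType) (D : pred I) (X : I -> {RV P >-> R}) :
    set (set Omega) :=
  [set E | exists (J : seq I) (B : I -> set R), [/\ uniq J, {subset J <= D},
     forall s, measurable (B s) & E = [set w | forall s, s \in J -> B s (X s w)]]].

Section cylinders.
Variables (I : choiceType) (X : I -> {RV P >-> R}).

(** An index constrained on one side only gets the constraint [setT] from the
    other side. *)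
Lemma cylinder_setI (D : pred I) : setI_closed (cylinder D X).
Proof.
move=> _ _ [J [B [uJ JD mB ->]]] [K [C [uK KD mC ->]]].
exists (undup (J ++ K)), (fun s => (if s \in J then B s else setT) `&`
  (if s \in K then C s else setT)); split.
- exact: undup_uniq.
- by move=> s; rewrite mem_undup mem_cat => /orP[/JD|/KD].
- by move=> s; apply: measurableI; case: ifP.
- apply/seteqP; split=> w /=.
    move=> [BJ CK] s _; split; case: ifP => // h; [exact: BJ|exact: CK].
  move=> BC; split=> s sJ; have := BC s; rewrite mem_undup mem_cat sJ ?orbT;
    by move=> /(_ isT)[].
Qed.

Lemma cylinder_measurable (D : pred I) : cylinder D X `<=` measurable.
Proof.
move=> _ [J [B [_ _ mB ->]]].
rewrite (_ : [set _ | _] = \big[setI/setT]_(s <- J) (X s @^-1` B s)).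
  by apply: bigsetI_measurable => s _; exact: measurable_funPTI.
rewrite -bigcap_seq; apply/seteqP; split=> w /= h s; exact: h.
Qed.

Lemma cylinder_setT (D : pred I) : cylinder D X setT.
Proof.
by exists [::], (fun=> setT); split => //; apply/seteqP; split => // w _ s.
Qed.

Lemma cylinder_measurable_fun (D : pred I) (s : I) : D s ->
  measurable_fun (setT : set (g_sigma_algebraType (cylinder D X))) (X s).
Proof.
move=> Ds _ B mB; rewrite setTI; apply: sub_sigma_algebra.
exists [:: s], (fun=> B); split => //.
  by move=> ?; rewrite inE => /eqP ->.
by apply/seteqP; split => w /=; [move=> h ?; rewrite inE => /eqP ->|apply; rewrite inE].
Qed.

(** For a fixed event on [X s0], the measures [E |-> P (E /\ X s0 \in A)] and
    [E |-> P (X s0 \in A) * P E] agree on the cylinders over the other indices,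
    by the product rule with [s0] added; as cylinders are stable under
    intersection, the two measures agree on the whole sigma-algebra generated. *)
Lemma mutually_independent_rv (D : pred I) (s0 : I) (Y : {RV P >-> R}) :
  mutually_independent D X -> D s0 ->
  measurable_fun
    (setT : set (g_sigma_algebraType (cylinder [pred s | D s & s != s0] X))) Y ->
  independent_rv (X s0) Y.
Proof.
move=> XI Ds0 mY A B mA mB.
have mXA : measurable (X s0 @^-1` A) by exact: measurable_funPTI.
set D' := [pred s | D s & s != s0] in mY.
have mYB : <<s cylinder D' X >> (Y @^-1` B).
  by have := mY measurableT B mB; rewrite setTI.
have PAfin : P (X s0 @^-1` A) \is a fin_num by exact: fin_num_measure.
pose c : {nonneg R} := NngNum (fine_ge0 (measure_ge0 P (X s0 @^-1` A))).
rewrite setIC.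
pose m1 : {measure set Omega -> \bar R} := mrestr P mXA.
pose m2 : {measure set Omega -> \bar R} := mscale c P.
transitivity (m2 (Y @^-1` B)); last by rewrite /m2/= /mscale/= fineK.
apply: (@g_sigma_algebra_measure_unique _ _ _ (cylinder D' X)
  (@cylinder_measurable _) (fun=> setT) _ _ m1 m2) => //.
- by move=> _; exact: cylinder_setT.
- by rewrite bigcup_const.
- exact: cylinder_setI.
- move=> _ [J [C [uJ JD mC ->]]].
  rewrite /m1/= /m2/= /mrestr/= /mscale/= fineK//.
  have s0J : s0 \notin J by apply/negP => /JD; rewrite inE eqxx andbF.
  have JD1 : {subset J <= D} by move=> s /JD; rewrite inE => /andP[].
  rewrite (XI J C uJ JD1 mC).
  (* the family [C] with the constraint [A] put at the new index [s0] *)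
  pose C' s := if s == s0 then A else C s.
  transitivity (P [set w | forall s, s \in s0 :: J -> C' s (X s w)]).
    congr (P _); apply/seteqP; split=> w /=.
      move=> [h1 h2] s; rewrite inE /C'; have [->//|ss0/= sJ] := eqVneq s s0.
      exact: h1.
    move=> h; split.
      move=> s sJ; have := h s; rewrite inE sJ orbT => /(_ isT).
      by rewrite /C'; case: eqVneq sJ s0J => // -> ->.
    by have := h s0; rewrite inE eqxx => /(_ isT); rewrite /C' eqxx.
  rewrite XI//=.
  + rewrite big_cons {1}/C' eqxx; congr (_ * _)%E.
    apply: eq_big_seq => s sJ; rewrite /C'.
    by case: eqVneq sJ s0J => // -> ->.
  + by rewrite s0J.
  + by move=> s; rewrite inE => /predU1P[->//|/JD1].
  + by move=> s; rewrite /C'; case: ifP.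
- move=> k; rewrite /m1/= /mrestr.
  by rewrite ltey_eq fin_num_measure//; exact: measurableI.
Qed.

End cylinders.
End independence.

(** * Uniform random variables *)

Section uniform.
Context d (Omega : measurableType d) (R : realType) (P : probability Omega R).
Variable X : {RV P >-> R}.
Local Notation mu := lebesgue_measure.

(** The density of the uniform law is with respect to the Lebesgue measure,
    which lives on [measurableTypeR R]: the same measurable sets as in the
    structure carried by [R], but a different structure. Hence [X] is pushed
    forward after retyping its codomain. *)
Lemma ge0_integral_uniformly_distributed (a b : R) (f : R -> R) :
  uniformly_distributed X a b -> continuous f -> (forall y, 0 <= f y) ->
  (\int[P]_w (f (X w))%:E = (b - a)^-1%:E * \int[mu]_(y in `[a, b]) (f y)%:E)%E.
Proof.
move=> [ab Xab] cf f0.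
pose RT := measurableTypeR R.
have mf : measurable_fun (setT : set RT) (fun y : RT => (f y)%:E).
  by apply/measurable_EFinP; exact: continuous_measurable_fun.
have mX : @measurable_fun _ _ Omega RT setT X by exact: (@measurable_funPT _ _ _ _ X).
transitivity (\int[pushforward P (X : Omega -> RT)]_(y in (setT : set RT)) (f y)%:E)%E.
  rewrite (@ge0_integral_pushforward _ _ Omega RT R X mX P setT (fun y => (f y)%:E))//.
  by move=> y _; rewrite lee_fin.
transitivity (\int[uniform_prob ab]_y (f y)%:E)%E.
  by apply: eq_measure_integral => B mB _; exact: Xab.
by rewrite integral_uniform// => y; rewrite lee_fin.
Qed.

Lemma integrable_uniformly_distributed (a b : R) :
  uniformly_distributed X a b -> P.-integrable setT (EFin \o X).
Proof.
move=> Xab; apply/integrableP; split; first exact/measurable_EFinP.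
have cabs : continuous (fun y : R => `|y|) by exact: norm_continuous.
rewrite (eq_integral (fun w => `|X w|%:E))//.
rewrite (ge0_integral_uniformly_distributed Xab cabs)//.
have /integrableP[_] : mu.-integrable `[a, b] (EFin \o (fun y : R => `|y|)).
  apply: continuous_compact_integrable; first exact: segment_compact.
  exact: continuous_subspaceT.
under eq_integral do rewrite /= normr_id.
move=> fin; have [ab _] := Xab.
by rewrite lte_mul_pinfty// lee_fin invr_ge0 subr_ge0 ltW.
Qed.

(** The substitution [y := - y] exchanges the integrals of the positive and of
    the negative part; integrability excludes the form [+oo - +oo]. *)
Lemma integral_symmetric_uniformly_distributed (a : R) :
  uniformly_distributed X (- a) a -> (\int[P]_w (X w)%:E = 0)%E.
Proof.
move=> Xa; have [aa _] := Xa.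
have cpos : continuous (fun y : R => Num.max y 0).
  by move=> y; apply: continuous_max; [exact: cvg_id|exact: cvg_cst].
have cneg : continuous (fun y : R => Num.max (- y) 0).
  by move=> y; apply: continuous_max; [exact: opp_continuous|exact: cvg_cst].
have intX : P.-integrable setT (EFin \o X) := integrable_uniformly_distributed Xa.
have eqpn : (\int[P]_w (Num.max (X w) 0)%:E = \int[P]_w (Num.max (- X w) 0)%:E)%E.
  rewrite (ge0_integral_uniformly_distributed Xa cpos); last first.
    by move=> y; rewrite le_max lexx orbT.
  rewrite (ge0_integral_uniformly_distributed Xa cneg); last first.
    by move=> y; rewrite le_max lexx orbT.
  congr (_ * _)%E.
  rewrite -{1}[a in `[_, a]]opprK integration_by_substitution_oppr//; last first.
  - exact: continuous_subspaceT.
  - exact: ltW.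
have posE w : ((EFin \o X)^\+ w = (Num.max (X w) 0)%:E)%E by rewrite EFin_max funeposE.
have negE w : ((EFin \o X)^\- w = (Num.max (- X w) 0)%:E)%E by rewrite EFin_max funenegE.
rewrite -[LHS]/(\int[P]_w (EFin \o X) w)%E integralE.
have := integrable_pos_fin_num measurableT intX.
under eq_integral do rewrite posE.
rewrite eqpn => negfin.
by under eq_integral do rewrite negE; rewrite subee.
Qed.

End uniform.

(** * Moments of the grey wolf positions *)

Section gwo.
Context d (Omega : measurableType d) (R : realType) (P : probability Omega R).
Variables (T : nat) (l r : R) (p : 'I_3 -> R).
Variables (A C : 'I_3 -> nat -> {RV P >-> R}) (x : nat -> {RV P >-> R}).
Hypothesis gwo : gwo_process T l r p A C x.

Let spread (k : 'I_3) (t : nat) (w : Omega) : R := `|C k t w * p k - x t w|.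

Let measurable_spread k t : measurable_fun setT (spread k t).
Proof.
apply: measurableT_comp => //; apply: measurable_funB => //.
exact: measurable_funM.
Qed.

HB.instance Definition _ k t := isMeasurableFun.Build _ _ _ _ (spread k t)
  (measurable_spread k t).

(** Sources drawn after time [t] are kept as well: independence from [A k t]
    only requires leaving [A k t] itself out. *)
Let others (k : 'I_3) (t : nat) : pred gwo_index :=
  [pred s | gwo_index_dom T s & s != Some (inl (k, t))].

Let but_A (k : 'I_3) (t : nat) :=
  g_sigma_algebraType (cylinder (others k t) (gwo_source (x 1%N) A C)).

(** Up to time [t] the recursion only consults coefficients drawn strictly
    before [t], so never [A k t]. *)
Lemma measurable_gwo_position k t u : (t < T)%N -> (1 <= u <= t)%N ->
  measurable_fun (setT : set (but_A k t)) (x u).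
Proof.
move=> tT; elim: u => // -[_ _|u IH /andP[_ ut]].
  exact: (@cylinder_measurable_fun _ _ _ P _ (gwo_source (x 1%N) A C) _ None).
have mx := IH (ltnW ut).
have uT : (1 <= u.+1 < T)%N by rewrite /= (ltn_trans ut).
apply: (@eq_measurable_fun _ _ (but_A k t) _ _ (fun w => 3^-1 * (\sum_(j < 3) p j) +
   3^-1 * (\sum_(j < 3) A j u.+1 w * `|C j u.+1 w * p j - x u.+1 w|))).
  by move=> w _; rewrite -(gwo_step gwo).
apply: measurable_funD => //; apply: measurable_funM => //.
apply: measurable_sum => j; apply: measurable_funM.
  apply: (@cylinder_measurable_fun _ _ _ P _ (gwo_source (x 1%N) A C) _
    (Some (inl (j, u.+1)))).
  rewrite /others/= (ltn_trans ut)//=; apply/eqP => -[_ ut'].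
  by rewrite ut' ltnn in ut.
apply: measurableT_comp => //; apply: measurable_funB => //.
apply: measurable_funM => //.
apply: (@cylinder_measurable_fun _ _ _ P _ (gwo_source (x 1%N) A C) _
  (Some (inr (j, u.+1)))).
by rewrite /others/= (ltn_trans ut).
Qed.

Lemma gwo_A_independent k t : (1 <= t < T)%N ->
  independent_rv (A k t) (spread k t).
Proof.
move=> tT; have [t1 ltT] := andP tT.
apply: (@mutually_independent_rv _ _ _ P _ (gwo_source (x 1%N) A C)
  (gwo_index_dom T) (Some (inl (k, t))) (spread k t)) => //.
  exact: (gwo_independent gwo).
apply: (@measurableT_comp _ _ _ (but_A k t)) => //.
apply: measurable_funB; last by apply: measurable_gwo_position => //; rewrite t1 /=.
apply: measurable_funM => //.
apply: (@cylinder_measurable_fun _ _ _ P _ (gwo_source (x 1%N) A C) _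
  (Some (inr (k, t)))).
by rewrite /others/= t1 ltT.
Qed.

Lemma integrable_gwo_spread k t : (1 <= t < T)%N ->
  P.-integrable setT (EFin \o x t) -> P.-integrable setT (EFin \o spread k t).
Proof.
move=> tT ix.
apply: (@integrable_norm _ _ _ P _ (fun w => C k t w * p k - x t w)).
rewrite (_ : _ \o _ = (fun w => (C k t w)%:E * (p k)%:E) \- (EFin \o x t))%E//.
apply: integrableB => //; apply: integrableZr => //.
exact: integrable_uniformly_distributed (gwo_uniformC gwo k tT).
Qed.

Lemma integrable_gwo_term k t : (1 <= t < T)%N ->
  P.-integrable setT (EFin \o x t) ->
  P.-integrable setT (fun w => (A k t w * spread k t w)%:E).
Proof.
move=> tT ix; apply: integrable_independentM.
- exact: gwo_A_independent.
- exact: integrable_uniformly_distributed (gwo_uniformA gwo k tT).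
- exact: integrable_gwo_spread.
Qed.

Let gwo_stepE t : (1 <= t < T)%N -> EFin \o x t.+1 =
  (fun w => (3^-1 * (\sum_(k < 3) p k))%:E +
     (3^-1)%:E * (\sum_(k < 3) (A k t w * spread k t w)%:E))%E.
Proof.
by move=> tT; apply/funext => w /=; rewrite (gwo_step gwo)// sumEFin.
Qed.

(** Integrability propagates through the recursion, each new term being the
    product of two independent integrable variables. *)
Lemma integrable_gwo_position t : (1 <= t <= T)%N ->
  P.-integrable setT (EFin \o x t).
Proof.
elim: t => // -[_ _|t IH /andP[_ tT]].
  exact: integrable_uniformly_distributed (gwo_init gwo).
rewrite gwo_stepE//; apply: integrableD => //.
  exact: finite_measure_integrable_cst.
apply: integrableZl => //; apply: integrable_sum => // k _.
by apply: integrable_gwo_term => //; exact: IH (ltnW tT).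
Qed.

Lemma expectation_gwo_step t : (1 <= t < T)%N ->
  ('E_P[x t.+1] = (3^-1 * (\sum_(k < 3) p k))%:E)%E.
Proof.
move=> tT; have [t1 ltT] := andP tT.
have ix : P.-integrable setT (EFin \o x t).
  by apply: integrable_gwo_position; rewrite t1 ltnW.
rewrite expectation_def.
under eq_integral do rewrite -[(x t.+1 _)%:E]/((EFin \o x t.+1) _) gwo_stepE//.
rewrite integralD//; last 2 first.
- exact: finite_measure_integrable_cst.
- apply: integrableZl => //; apply: integrable_sum => // k _.
  exact: integrable_gwo_term.
have -> : (\int[P]_(_ in setT) (3^-1 * \sum_(k < 3) p k)%:E =
    (3^-1 * \sum_(k < 3) p k)%:E)%E.
  by rewrite integral_cst//= probability_setT mule1.
rewrite integralZl//; last first.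
  by apply: integrable_sum => // k _; exact: integrable_gwo_term.
rewrite integral_sum//; last by move=> k; exact: integrable_gwo_term.
rewrite [X in (_ * X)%E]big1 ?mule0 ?adde0// => k _.
rewrite integral_independentM.
- by rewrite (integral_symmetric_uniformly_distributed (gwo_uniformA gwo k tT)) mul0e.
- exact: gwo_A_independent.
- exact: integrable_uniformly_distributed (gwo_uniformA gwo k tT).
- exact: integrable_gwo_spread.
Qed.

End gwo.

Theorem proposition3p4 (R : realType) (m n : nat)
    (l r : 'I_n -> R) (p : 'I_3 -> 'I_n -> R)
    (d : nat -> measure_display) (Omega : forall T, measurableType (d T))
    (P : forall T, probability (Omega T) R)
    (A C : forall T, 'I_m -> 'I_3 -> 'I_n -> nat -> {RV (P T) >-> R})
    (x : forall T, 'I_m -> 'I_n -> nat -> {RV (P T) >-> R})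
    (lr : forall j, l j < r j)
    (gwo : forall T i j, (1 <= T)%N ->
      gwo_process T (l j) (r j) (fun k => p k j)
        (fun k => A T i k j) (fun k => C T i k j) (x T i j)) :
  order1_stable x.
Proof.
move=> i j; exists (3^-1 * (\sum_(k < 3) p k j)).
apply: cvg_near_cst; near=> T.
have T2 : (1 <= T.-1 < T)%N.
  have : (2 <= T)%N by near: T; exact: nbhs_infty_ge.
  by case: (T) => [//|[//|t]] _ /=.
have [T0 ltT] := andP T2.
have := expectation_gwo_step (gwo T i j (leq_ltn_trans (leq0n _) ltT)) T2.
by rewrite prednK// (leq_ltn_trans _ ltT).
Unshelve. all: by end_near. Qed.
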